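(* Let $T$ be a (linear) isometry on a Hilbert space $\mathcal{H}$, and let $f$ be any nonzero element of $\mathcal{H}$. Let $K:\mathbb{N}\to\mathbb{N}$ be any nondecreasing function satisfying $K(n)\ge n$ for every $n$. For $\varepsilon>0$ put $$\rho=\lceil \|f\|/\varepsilon\rceil,\qquad \widehat K(i)=i+2^{13}\rho^4\,K\big((i+1)\,K(1)\,\rho^2\big),\qquad e=2^9\rho^2 .$$ Then for every $\varepsilon>0$ there is an $n$ satisfying $1\le n\le \widehat K^{e}(1)$ such that for every $m\in[n,K(n)]$, $\|A_mf-A_nf\|\le\varepsilon$.
   Context: For an operator $T$ on a Hilbert space and an integer $n\ge1$, $A_nf=\frac1n\sum_{i<n}T^if$ (sum over $0\le i<n$). $\widehat K^{e}(1)$ denotes the $e$-fold iterate of $\widehat K$ applied to $1$. The interval $[n,K(n)]$ is an interval of integers. *)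

(* Defs.v *)
From HB Require Import structures.
From mathcomp Require Import all_boot all_order all_algebra.
From mathcomp Require Import complex.
From mathcomp Require Import all_classical all_reals all_analysis.

Set Implicit Arguments.
Unset Strict Implicit.
Unset Printing Implicit Defensive.

Import Order.TTheory GRing.Theory Num.Theory.
Import numFieldNormedType.Exports.

Local Open Scope ring_scope.

(* Hilbert spaces over both R and R[i] are considered: complete normed modules
   whose norm is induced by an inner product (linear on the left). The norm of
   a normed module over R[i] takes its values in R[i], where it is a
   nonnegative real, so [complex.Re `|x|] is the norm of x as an element of R. *)

(* At n = 0 the value is the junk value 0. *)
Definition ergodic_avg (F : numFieldType) (H : lmodType F) (T : H -> H)
    (n : nat) (f : H) : H :=
  n%:R^-1 *: \sum_(i < n) iter i T f.

(* Only meaningful for 0 <= x, where the ceiling is a nonnegative integer. *)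
Definition ceil_nat (R : realType) (x : R) : nat := `|Num.ceil x|%N.

Definition Khat (K : nat -> nat) (rho : nat) (i : nat) : nat :=
  (i + 2 ^ 13 * rho ^ 4 * K (i.+1 * K 1 * rho ^ 2))%N.

(* Main.v *)
Require Import Defs.
From HB Require Import structures.
From mathcomp Require Import all_boot all_order all_algebra.
From mathcomp Require Import complex.
From mathcomp Require Import all_classical all_reals all_analysis.
From mathcomp Require Import ring lra.
Import Order.TTheory GRing.Theory Num.Theory.
Import numFieldNormedType.Exports.
Local Open Scope ring_scope.

(** The argument is a quantitative form of the classical proof that the averages
    [A_n f] converge because their norms approach the minimal norm in the convex
    hull of the orbit of [f].

    Shifting the window of an average moves only its two ends, so
    [A_m (A_n f)] and [A_m f] differ by at most [2 n |f| / m]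
    ([ergodic_avg_avg_le]).  Two consequences hold when the ratio [m / n] is at
    least a large [M].  As [A_m] is a contraction, [|A_m f|] exceeds [|A_n f|]
    by at most [2 |f| / M]
    ([ergodic_avg_almost_decreasing]).  And if [m] and [p] are both much smaller
    than [N], then [A_N] sends [A_m f + A_p f] close to [2 A_N f], so that
    [|A_m f + A_p f|] is at least about [2 |A_N f|].

    Suppose that [n] is followed by [p <= m], which are followed by [N], with
    ratios [M] at both gaps.  The parallelogram law then bounds
    [|A_m f - A_p f|^2] by four times the decrease of [|A f|^2] from [n] to [N],
    up to errors of order [|f|^2 / M] ([ergodic_avg_dist]).  With
    [M = 64 rho^2] these errors are a fixed fraction of [eps^2].

    Now take times [n_0 = 1] and [n_(i+1) = M K(M n_i)], so that every [m] in
    [[M n_i, K (M n_i)]] lies between [n_i] and [n_(i+1)] with the required gaps.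
    The nonnegative numbers [|A_(n_i) f|^2] start at [|f|^2 <= rho^2 eps^2], so
    among the first [16 rho^2] of them one drops by at most [eps^2 / 16], and
    [M n_i] is then the wanted index.  Since
    [M n_(i+1) = 2^12 rho^4 K (M n_i)], one application of [Khat] dominates one
    step of this recursion ([times_le]).

    Only the real number [|x|] and the parallelogram law enter, so real and
    complex scalars are treated together through a real-valued function [nu]
    satisfying [hilbertian]. *)

Set Implicit Arguments.
Unset Strict Implicit.
Unset Printing Implicit Defensive.

(** * Linearity of ergodic averages *)

Section ErgodicAverageLinear.
Context (F : numFieldType) (H : lmodType F) (T : {linear H -> H}).

Lemma iter_is_linear i : linear (iter i T).
Proof. by elim: i => [|i IH] a x y //=; rewrite IH linearP. Qed.

Lemma ergodic_avg_is_linear n : linear (ergodic_avg T n).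
Proof.
move=> a x y; rewrite /ergodic_avg.
under eq_bigr do rewrite iter_is_linear.
by rewrite big_split /= -scaler_sumr scalerDr !scalerA mulrC.
Qed.

HB.instance Definition _ n :=
  GRing.isLinear.Build F H H _ (ergodic_avg T n) (ergodic_avg_is_linear n).

Lemma ergodic_avgMn n x :
  (0 < n)%N -> ergodic_avg T n x *+ n = \sum_(i < n) iter i T x.
Proof.
move=> n_gt0; rewrite /ergodic_avg -scaler_nat scalerA divff ?scale1r //.
by rewrite pnatr_eq0 -lt0n.
Qed.

(** The sum telescopes: this is why averages over long windows are almost
    invariant under the map. *)
Lemma ergodic_avg_shift n x : (0 < n)%N ->
  (ergodic_avg T n (T x) - ergodic_avg T n x) *+ n = iter n T x - x.
Proof.
move=> n_gt0; rewrite mulrnBl !ergodic_avgMn // -sumrB.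
under eq_bigr do rewrite -iterSr.
by rewrite -(big_mkord xpredT (fun i => iter i.+1 T x - iter i T x))
  telescope_sumr.
Qed.

End ErgodicAverageLinear.

(** * Averages of a contraction in a Hilbertian norm *)

(** The norm is a function into [R] rather than the norm of a normed module, so
    that over complex scalars it can be the real part of the complex-valued
    norm.  Homogeneity under natural multiples suffices because averages involve
    no other scalars. *)
Record hilbertian (R : numDomainType) (V : zmodType) (nu : V -> R) : Prop := {
  hilbertian_ge0 : forall x, 0 <= nu x;
  hilbertianN : forall x, nu (- x) = nu x;
  hilbertianMn : forall x n, nu (x *+ n) = nu x *+ n;
  hilbertianD : forall x y, nu (x + y) <= nu x + nu y;
  hilbertian_parallelogram : forall x y,
    nu (x + y) ^+ 2 + nu (x - y) ^+ 2 = 2 * (nu x ^+ 2 + nu y ^+ 2) }.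

Section Contraction.
Context (R : realFieldType) (F : numFieldType) (H : lmodType F) (nu : H -> R).
Context (nuH : hilbertian nu) (T : {linear H -> H}).
Context (T_contr : forall x, nu (T x) <= nu x).

Local Notation A := (ergodic_avg T).

Lemma hilbertian0 : nu 0 = 0.
Proof. by rewrite -(mulr0n (0 : H)) hilbertianMn. Qed.

Lemma hilbertian_sum_le n (u : 'I_n -> H) (c : R) :
  (forall i, nu (u i) <= c) -> nu (\sum_i u i) <= c *+ n.
Proof.
move=> u_le; rewrite -[n in c *+ n]card_ord -sumr_const.
apply: (big_ind2 (fun x y => nu x <= y)) => //; first by rewrite hilbertian0.
by move=> x a y b xa yb; apply: le_trans (hilbertianD nuH _ _) (lerD xa yb).
Qed.

Lemma hilbertian_iter_le i x : nu (iter i T x) <= nu x.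
Proof. by elim: i => //= i; exact: le_trans. Qed.

Lemma ergodic_avg_le n x : nu (A n x) <= nu x.
Proof.
case: n => [|n].
  by rewrite /ergodic_avg big_ord0 scaler0 hilbertian0 hilbertian_ge0.
rewrite -(ler_pMn2r (ltn0Sn n)) -hilbertianMn // ergodic_avgMn //.
by apply: hilbertian_sum_le => i; exact: hilbertian_iter_le.
Qed.

Lemma ergodic_avg_iter_le m i x : (0 < m)%N ->
  nu (A m (iter i T x) - A m x) *+ m <= nu x *+ 2 *+ i.
Proof.
move=> m_gt0; elim: i => [|i IH] /=.
  by rewrite subrr hilbertian0 mul0rn.
set y := iter i T x in IH *.
rewrite -[A m (T y)](subrK (A m y)) -addrA mulrSr [leRHS]addrC.
apply: le_trans (ler_wMn2r m (hilbertianD nuH _ _)) _.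
rewrite mulrnDl; apply: lerD IH.
rewrite -hilbertianMn // ergodic_avg_shift // mulr2n.
apply: le_trans (hilbertianD nuH _ _) _; rewrite hilbertianN //.
by apply: lerD; rewrite -?iterD hilbertian_iter_le.
Qed.

(** [A_m (A_n x) - A_m x] is the mean over [i < n] of the differences
    [A_m (T^i x) - A_m x], each of norm at most [2 i |x| / m]. *)
Lemma ergodic_avg_avg_le (M m n : nat) x : (0 < M)%N -> (0 < n)%N ->
  (M * n <= m)%N -> nu (A m (A n x) - A m x) <= 2 * nu x / M%:R.
Proof.
move=> M_gt0 n_gt0 le_m.
have m_gt0 : (0 < m)%N by rewrite (leq_trans _ le_m) // muln_gt0 M_gt0.
rewrite ler_pdivlMr ?ltr0n // mulr_natr mulr_natl -(ler_pMn2r n_gt0).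
set E := A m (A n x) - A m x.
apply: (@le_trans _ _ (nu E *+ m)).
  by rewrite -mulrnA; apply: ler_wpMn2l => //; exact: hilbertian_ge0.
rewrite -(ler_pMn2r n_gt0) -(hilbertianMn nuH E m) -(hilbertianMn nuH (E *+ m)).
have -> : E *+ m *+ n = \sum_(i < n) (A m (iter i T x) - A m x) *+ m.
  rewrite sumrMnl sumrB sumr_const card_ord -raddf_sum -ergodic_avgMn //.
  by rewrite raddfMn -mulrnBl mulrnAC.
apply: hilbertian_sum_le => i; rewrite hilbertianMn //.
apply: le_trans (ergodic_avg_iter_le _ _ m_gt0) _.
apply: ler_wpMn2l; first by rewrite mulrn_wge0 // hilbertian_ge0.
exact: ltnW.
Qed.

Lemma ergodic_avg_almost_decreasing (M m n : nat) x :
  (0 < M)%N -> (0 < n)%N -> (M * n <= m)%N ->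
  nu (A m x) <= nu (A n x) + 2 * nu x / M%:R.
Proof.
move=> M_gt0 n_gt0 le_m.
have -> : A m x = A m (A n x) - (A m (A n x) - A m x) by rewrite subKr.
apply: le_trans (hilbertianD nuH _ _) _; rewrite hilbertianN //.
by apply: lerD; [exact: ergodic_avg_le | exact: ergodic_avg_avg_le].
Qed.

(** The lower bound for [A_m x + A_p x] that the parallelogram law needs comes
    from a later time: the contraction [A_N] maps this sum close to [2 A_N x]. *)
Lemma ergodic_avg_dist (M n p m N : nat) x : (0 < M)%N -> (0 < n)%N ->
  (M * n <= p)%N -> (p <= m)%N -> (M * m <= N)%N ->
  nu (A m x - A p x) ^+ 2 <= 4 * (nu (A n x) ^+ 2 - nu (A N x) ^+ 2)
    + 32 * (nu x ^+ 2 / M%:R) + 16 * (nu x / M%:R) ^+ 2.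
Proof.
move=> M_gt0 n_gt0 le_p le_pm le_N; pose d := 2 * nu x / M%:R.
have M_neq0 : M%:R != 0 :> R by rewrite pnatr_eq0 -lt0n.
have -> : nu x ^+ 2 / M%:R = d * nu x / 2 by rewrite /d; field.
have -> : nu x / M%:R = d / 2 by rewrite /d; field.
have p_gt0 : (0 < p)%N by rewrite (leq_trans _ le_p) // muln_gt0 M_gt0.
have m_gt0 : (0 < m)%N := leq_trans p_gt0 le_pm.
have hm : nu (A m x) <= nu (A n x) + d.
  by apply: ergodic_avg_almost_decreasing; rewrite ?(leq_trans le_p).
have hp : nu (A p x) <= nu (A n x) + d by exact: ergodic_avg_almost_decreasing.
have hN : nu (A N x) *+ 2 <= nu (A m x + A p x) + 2 * d.
  have -> : nu (A N x) *+ 2 = nu (A N (A m x + A p x)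
      - ((A N (A m x) - A N x) + (A N (A p x) - A N x))).
    rewrite -hilbertianMn // [in RHS]raddfD /= addrACA -opprD mulr2n.
    by congr nu; rewrite subKr.
  apply: le_trans (hilbertianD nuH _ _) _; rewrite hilbertianN //.
  apply: lerD; first exact: ergodic_avg_le.
  rewrite mulr_natl mulr2n; apply: le_trans (hilbertianD nuH _ _) _.
  apply: lerD; apply: ergodic_avg_avg_le => //.
  by rewrite (leq_trans _ le_N) // leq_mul2l le_pm orbT.
have hpar := hilbertian_parallelogram nuH (A m x) (A p x).
have := hilbertian_ge0 nuH (A m x); have := hilbertian_ge0 nuH (A p x).
have := hilbertian_ge0 nuH (A n x); have := hilbertian_ge0 nuH (A N x).
have := hilbertian_ge0 nuH (A m x + A p x).
have := ergodic_avg_le n x; have := ergodic_avg_le N x.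
have d_ge0 : 0 <= d by rewrite divr_ge0 ?mulr_ge0 ?ler0n ?hilbertian_ge0.
move: (nu (A m x)) (nu (A p x)) (nu (A n x)) (nu (A N x)) (nu x) hm hp hN hpar.
move: (nu (_ + _)) (nu (_ - _)) d d_ge0 => s t d d_ge0.
move=> a b u v c hm hp hN hpar vc uc s0 v0 u0 b0 a0.
have ha : a ^+ 2 <= (u + d) ^+ 2 by rewrite ler_pXn2r ?nnegrE ?addr_ge0.
have hb : b ^+ 2 <= (u + d) ^+ 2 by rewrite ler_pXn2r ?nnegrE ?addr_ge0.
(* Squaring [2 v <= s + 2 d]; when [2 v < 2 d] the left-hand side is negative
   and the bound is trivial. *)
have hs : (v *+ 2) ^+ 2 - 8 * (d * v) <= s ^+ 2.
  have [le_dv|lt_vd] := leP (2 * d) (v *+ 2); last by nra.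
  have : (v *+ 2 - 2 * d) ^+ 2 <= s ^+ 2 by rewrite ler_pXn2r ?nnegrE ?subr_ge0 ?lerBlDr.
  by nra.
by nra.
Qed.

End Contraction.

(** * Choice of the times *)

Lemma pigeonhole_decrease (R : realFieldType) (a : nat -> R) (k : nat) (d : R) :
  (0 < k)%N -> (forall i, 0 <= a i) -> a 0 <= d *+ k ->
  exists2 i, (i < k)%N & a i - a i.+1 <= d.
Proof.
move=> k_gt0 a_ge0 a0_le.
have [/existsP[i hi]|] := boolP [exists i : 'I_k, a i - a i.+1 <= d].
  by exists i.
rewrite negb_exists => /forallP lt_d; exfalso.
have : d *+ k < a 0 - a k.
  rewrite -opprB -(telescope_sumr _ (leq0n k)) -sumrN big_mkord.
  rewrite -[k in d *+ k]card_ord -sumr_const.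
  apply: ltr_sum; last by move=> i _; rewrite opprB ltNge lt_d.
  by apply/hasP; exists (Ordinal k_gt0); rewrite ?mem_index_enum.
by rewrite ltNge lerBlDr (le_trans a0_le) // lerDl.
Qed.

Section Times.
Context (K : nat -> nat).
Context (Kmono : {homo K : m n / (m <= n)%N}) (K_ge : forall n, (n <= K n)%N).
Context (rho : nat) (rho_gt0 : (0 < rho)%N).

Local Notation M := (2 ^ 6 * rho ^ 2)%N.

(** The factor [M] inside [K] separates the window [[M n, K (M n)]] from [n],
    and the outer one separates the next time from this window. *)
Definition times i := iter i (fun n => M * K (M * n))%N 1%N.

Lemma ratio_gt0 : (0 < M)%N.
Proof. by rewrite muln_gt0 !expn_gt0 rho_gt0. Qed.

Lemma rate_gt0 n : (0 < n)%N -> (0 < K n)%N.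
Proof. by move=> n_gt0; rewrite (leq_trans n_gt0). Qed.

Lemma times_gt0 i : (0 < times i)%N.
Proof.
by elim: i => //= i IH; rewrite muln_gt0 ratio_gt0 rate_gt0 // muln_gt0 ratio_gt0.
Qed.

(** The factor [2 ^ 13 * rho ^ 4] of [Khat] absorbs [M ^ 2 = 2 ^ 12 * rho ^ 4],
    and its argument of [K] is at least [b] because [K 1] and [rho] are
    positive. *)
Lemma leq_Khat_step n b : (n <= b)%N -> (M * (M * K n) <= Khat K rho b)%N.
Proof.
move=> le_nb; rewrite /Khat mulnA mulnACA -expnD -expnD.
apply: leq_trans (leq_addl _ _); apply: leq_mul.
  by rewrite leq_mul2r leq_pexp2l ?orbT.
apply: Kmono; rewrite (leq_trans le_nb) //.
rewrite -mulnA (leq_trans (leqnSn b)) // leq_pmulr //.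
by rewrite muln_gt0 K_ge expn_gt0 rho_gt0.
Qed.

(** The extra iterate pays for the initial factor [M]. *)
Lemma times_le i : (M * times i <= iter i.+1 (Khat K rho) 1)%N.
Proof.
elim: i => [|i IH]; last exact: leq_Khat_step.
apply: leq_trans (leq_Khat_step (leqnn 1)).
by rewrite muln1 leq_pmulr // muln_gt0 ratio_gt0 rate_gt0.
Qed.

Lemma leq_iter_Khat i j :
  (i <= j)%N -> (iter i (Khat K rho) 1 <= iter j (Khat K rho) 1)%N.
Proof.
move/subnK => <-; rewrite iterD; elim: (j - i)%N => //= k IH.
exact: leq_trans IH (leq_addr _ _).
Qed.

End Times.

(** * Metastability *)

Lemma hilbertian_metastability (R : realType) (F : numFieldType)
    (H : lmodType F) (nu : H -> R) (nuH : hilbertian nu)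
    (T : {linear H -> H}) (T_contr : forall x, nu (T x) <= nu x)
    (K : nat -> nat) (Kmono : {homo K : m n / (m <= n)%N})
    (K_ge : forall n, (n <= K n)%N)
    (eps : R) (eps_gt0 : 0 < eps) (f : H) (f_gt0 : 0 < nu f) :
  let rho := ceil_nat (nu f / eps) in
  exists n : nat, (1 <= n <= iter (2 ^ 9 * rho ^ 2) (Khat K rho) 1)%N /\
    forall m : nat, (n <= m <= K n)%N ->
      nu (ergodic_avg T m f - ergodic_avg T n f) <= eps.
Proof.
move=> rho.
have rhoE : nu f / eps <= rho%:R.
  rewrite /rho /ceil_nat natr_absz.
  rewrite ger0_norm; first exact: ceil_ge.
  by rewrite ceil_ge0 (lt_le_trans (ltrN10 _)) // divr_ge0 // ltW.
have rho_gt0 : (0 < rho)%N.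
  by rewrite -(ltr0n R) (lt_le_trans _ rhoE) // divr_gt0.
have f_le : nu f <= rho%:R * eps by rewrite -ler_pdivrMr.
pose M := (2 ^ 6 * rho ^ 2)%N.
have M_gt0 : (0 < M)%N by rewrite muln_gt0 !expn_gt0 rho_gt0.
pose a i := nu (ergodic_avg T (times K rho i) f) ^+ 2.
have [|||i lt_i a_le] := @pigeonhole_decrease _ a (2 ^ 4 * rho ^ 2) (eps ^+ 2 / 16).
- by rewrite muln_gt0 !expn_gt0 rho_gt0.
- by move=> i; exact: sqr_ge0.
- rewrite /a /= /ergodic_avg big_ord1 invr1 scale1r /= -(mulr_natr (_ / 16)) natrM.
  have : nu f ^+ 2 <= (rho%:R * eps) ^+ 2.
    by rewrite ler_pXn2r ?nnegrE ?mulr_ge0 ?ler0n ?(ltW eps_gt0) ?(ltW f_gt0).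
  rewrite exprMn => /le_trans; apply; rewrite !natrX; lra.
exists (M * times K rho i)%N; split.
  rewrite muln_gt0 M_gt0 (times_gt0 K_ge) //=.
  apply: leq_trans (times_le Kmono K_ge rho_gt0 i) _.
  apply: leq_iter_Khat; apply: leq_trans lt_i _.
  by rewrite leq_mul2r leq_pexp2l ?orbT.
move=> m /andP[le_m m_le].
rewrite -(@ler_pXn2r _ 2) ?nnegrE ?hilbertian_ge0 ?(ltW eps_gt0) //.
have le_N : (M * m <= times K rho i.+1)%N by rewrite leq_mul2l m_le orbT.
have := ergodic_avg_dist nuH T_contr f M_gt0 (times_gt0 K_ge rho_gt0 i)
  (leqnn _) le_m le_N.
move=> /le_trans; apply.
rewrite -/(a i) -/(a i.+1).
have ME : M%:R = 64 * rho%:R ^+ 2 :> R by rewrite /M natrM !natrX; ring.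
have rho_ge1 : 1 <= rho%:R :> R by rewrite ler1n.
have M_pos : 0 < M%:R :> R by rewrite ltr0n.
(* The three contributions to the squared distance are at most [eps^2 / 4],
   [eps^2 / 2] and [eps^2 / 256]. *)
have q1 : nu f ^+ 2 / M%:R <= eps ^+ 2 / 64.
  by rewrite ler_pdivrMr // ME; nra.
have q2 : (nu f / M%:R) ^+ 2 <= (eps / 64) ^+ 2.
  rewrite ler_pXn2r ?nnegrE ?divr_ge0 ?(ltW eps_gt0) ?(ltW f_gt0) //.
  by rewrite ler_pdivrMr // ME; nra.
by have := sqr_ge0 eps; lra.
Qed.

(** The form may be bilinear or sesquilinear: in the sum of the expansions of
    [dot (x + y) (x + y)] and [dot (x - y) (x - y)] the mixed terms cancel without
    use of the symmetry of [dot]. *)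
Lemma hilbertian_inner_norm (C : numFieldType) (R : realFieldType)
    (iota : {rmorphism R -> C}) (iota_le : {mono iota : x y / x <= y})
    (theta : C -> C) (H : normedModType C) (dot : {dot H for theta})
    (normE : forall x : H, dot x x = `|x| ^+ 2)
    (nu : H -> R) (nuE : forall x, iota (nu x) = `|x|) : hilbertian nu.
Proof.
have iota_inj : injective iota.
  by move=> x y /eqP; rewrite eq_le !iota_le -eq_le => /eqP.
split=> [x|x|x n|x y|x y].
- by rewrite -iota_le rmorph0 nuE.
- by apply: iota_inj; rewrite !nuE normrN.
- by apply: iota_inj; rewrite rmorphMn /= !nuE normrMn.
- by rewrite -iota_le rmorphD /= !nuE ler_normD.
- apply: iota_inj; rewrite mulr_natl rmorphMn !rmorphD !rmorphXn /= !nuE -!normE.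
  rewrite !linearDl !linearDr !linearNl !linearNr.
  by ring.
Qed.

Theorem theorem2p13 (R : realType) (K : nat -> nat)
    (Kmono : {homo K : m n / (m <= n)%N}) (K_ge : forall n : nat, (n <= K n)%N)
    (eps : R) (eps_gt0 : 0 < eps) :
  (forall (H : completeNormedModType R) (dot : {dot H for idfun})
      (normE : forall x : H, dot x x = `|x| ^+ 2)
      (T : {linear H -> H}) (T_isom : forall x : H, `|T x| = `|x|)
      (f : H) (f_neq0 : f != 0),
    let rho := ceil_nat (`|f| / eps) in
    let e := (2 ^ 9 * rho ^ 2)%N in
    exists n : nat, (1 <= n <= iter e (Khat K rho) 1)%N /\
      forall m : nat, (n <= m <= K n)%N ->
        `|ergodic_avg T m f - ergodic_avg T n f| <= eps)
  /\
  (forall (H : completeNormedModType R[i]) (dot : {dot H for Num.conj})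
      (normE : forall x : H, dot x x = `|x| ^+ 2)
      (T : {linear H -> H}) (T_isom : forall x : H, `|T x| = `|x|)
      (f : H) (f_neq0 : f != 0),
    let rho := ceil_nat (complex.Re `|f| / eps) in
    let e := (2 ^ 9 * rho ^ 2)%N in
    exists n : nat, (1 <= n <= iter e (Khat K rho) 1)%N /\
      forall m : nat, (n <= m <= K n)%N ->
        complex.Re `|ergodic_avg T m f - ergodic_avg T n f| <= eps).
Proof.
split=> H dot normE T T_isom f f_neq0 rho e.
  apply: (@hilbertian_metastability _ _ _ (fun x : H => `|x|)) => //.
  - exact: (@hilbertian_inner_norm _ _ idfun).
  - by move=> x; rewrite T_isom.
  - by rewrite normr_gt0.
have ReE (x : H) : (complex.Re `|x|)%:C%C = `|x|.
  by rewrite RRe_real // normr_real.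
apply: (@hilbertian_metastability _ _ _ (fun x : H => complex.Re `|x|)) => //.
- apply: (@hilbertian_inner_norm _ _ (real_complex R)) normE _ _ => //.
  exact: lecR.
- by move=> x; rewrite T_isom.
- by rewrite -ltcR ReE normr_gt0.
Qed.
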